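(* Assume that the problem $$\mathcal{F}[\xi,u]=f \ \text{ in } Q,\qquad \mathcal{B}u=g\ \text{ on }\Gamma \tag{P}$$ is well-posed. Then $u\in X$ solves (P) if and only if $u\in X$ solves the constrained optimization problem $$\inf_{u\in U}\ \tfrac12\,\mathrm{dist}(\mathcal{B}u,g)^2,\qquad U=\{u\in X:\ \mathcal{F}[\xi,u]=f\ \text{in } Q\},$$ i.e. if and only if $u\in U$ and $\mathrm{dist}(\mathcal{B}u,g)^2\le \mathrm{dist}(\mathcal{B}w,g)^2$ for all $w\in U$.
   Context: $Q\subset\mathbb{R}^d$ ($d>1$) is a bounded domain with boundary $\partial Q$, and $\Gamma\subset\partial Q$ is the portion of the boundary on which boundary conditions are imposed. $X$ is a (real) Banach space of functions on $Q$, $Z$ is a (real) Hilbert space of functions on $Q$, and $P$ is a (real) Banach space of functions on $\Gamma$. $\mathcal{F}:Q\times X\to Z$ is a (possibly nonlinear) differential operator, written $u\mapsto\mathcal{F}[\xi,u]\in Z$ for $u\in X$ ($\xi$ denotes the variable in $Q$), and $\mathcal{B}:X\to P$ is a boundary operator. The data are $f\in Z$, $g\in P$. The function $\mathrm{dist}(\cdot,\cdot)$ is a metric (measuring the mismatch of boundary data). Well-posedness is in the usual (Hadamard) sense; in particular, for every choice of data in $Z\times P$ the problem has a unique solution in $X$. *)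

(* Defs.v *)
From HB Require Import structures.
From mathcomp Require Import all_boot all_order all_algebra.
From mathcomp Require Import all_classical all_reals all_analysis.

Set Implicit Arguments.
Unset Strict Implicit.
Unset Printing Implicit Defensive.

Import Order.TTheory GRing.Theory Num.Theory.
Import numFieldNormedType.Exports.

Local Open Scope classical_set_scope.
Local Open Scope ring_scope.

Definition domain (R : realType) (d : nat) (Q : set 'rV[R]_d) : Prop :=
  [/\ Q !=set0, open Q & connected Q].

Definition boundary (T : topologicalType) (A : set T) : set T :=
  closure A `\` interior A.

(* Presents V as a space of W-valued functions on D. The elements of V are
   identified with functions up to a fixed notion of "almost everywhere", given
   by a filter: it is [set setT] for spaces of genuine functions (such as C^k
   spaces) and the almost-everywhere filter of a measure for Lebesgue and
   Sobolev spaces. The values of [fs_val u] outside D are irrelevant. *)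
Record function_space (R : realType) (T : Type) (D : set T)
    (W V : lmodType R) := FunctionSpace {
  fs_ae : set_system T ;
  fs_ae_filter : Filter fs_ae ;
  fs_val : V -> T -> W ;
  fs_val_linear : forall (a : R) (u v : V),
    \forall x \near fs_ae, D x ->
      fs_val (a *: u + v) x = a *: fs_val u x + fs_val v x ;
  fs_val_inj : forall u v : V,
    (\forall x \near fs_ae, D x -> fs_val u x = fs_val v x) -> u = v
}.

(* u = v in D, as functions *)
Definition fs_eq (R : realType) (T : Type) (D : set T) (W V : lmodType R)
    (S : function_space D W V) (u v : V) : Prop :=
  \forall x \near fs_ae S, D x -> fs_val S u x = fs_val S v x.

(* The norm of the Banach space Z is induced by the inner product ip, i.e. Z
   is a Hilbert space. *)
Definition hilbert_norm (R : realType) (Z : completeNormedModType R)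
    (ip : {dot Z for (@idfun R)}) : Prop :=
  forall z : Z, `|z| ^+ 2 = ip z z.

(* A metric on P is not required to be related to the norm of P, hence not
   the metricType structure. *)
Record is_metric (R : realType) (P : Type) (dist : P -> P -> R) : Prop :=
  IsMetric {
  dist_ge0 : forall x y, 0 <= dist x y ;
  dist_eq0 : forall x y, dist x y = 0 <-> x = y ;
  dist_sym : forall x y, dist x y = dist y x ;
  dist_triangle : forall x y z, dist x z <= dist x y + dist y z
}.

Section BoundaryValueProblem.
Context (R : realType) (d : nat) (Q Gamma : set 'rV[R]_d).
Context (X Z P : completeNormedModType R) (WZ WP : lmodType R).
Context (SZ : function_space Q WZ Z) (SP : function_space Gamma WP P).
(* F u is the function xi |-> F[xi, u] on Q. *)
Context (F : X -> Z) (B : X -> P).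

Definition solves_pde (f : Z) (u : X) : Prop := fs_eq SZ (F u) f.

Definition solves_bc (g : P) (u : X) : Prop := fs_eq SP (B u) g.

Definition solves_bvp (f : Z) (g : P) (u : X) : Prop :=
  solves_pde f u /\ solves_bc g u.

(* Hadamard: existence and uniqueness for all data, and continuity of the
   data-to-solution map. *)
Definition well_posed : Prop :=
  (forall (f : Z) (g : P), exists! u : X, solves_bvp f g u) /\
  (forall sol : Z * P -> X,
     (forall (f : Z) (g : P), solves_bvp f g (sol (f, g))) -> continuous sol).

End BoundaryValueProblem.

(* u solves the problem inf_(w in U) J w: it is feasible and attains the
   infimum. *)
Definition solves_inf (R : realType) (X : Type) (J : X -> R) (U : set X)
    (u : X) : Prop :=
  U u /\ J u = inf [set J w | w in U].

(* Main.v *)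
Require Import Defs.
From HB Require Import structures.
From mathcomp Require Import all_boot all_order all_algebra.
From mathcomp Require Import all_classical all_reals all_analysis.
Import Order.TTheory GRing.Theory Num.Theory.
Import numFieldNormedType.Exports.
Local Open Scope classical_set_scope.
Local Open Scope ring_scope.

(** The mismatch [dist (B w) g] is nonnegative and vanishes exactly when [w]
    satisfies the boundary condition, so everything hinges on the value of the
    infimum over the feasible set [U]. Solvability of the boundary value problem
    for the data [(f, g)] provides a feasible point with zero mismatch; hence
    the infimum is [0], it is attained, and the minimizers are precisely the
    feasible points with zero mismatch ([zero_minimizerP]), that is, the
    solutions of the boundary value problem. Both descriptions of a minimizer,
    attaining the infimum and minorizing the objective on [U], agree because
    the objective is bounded below ([solves_infP]). *)

(** Functions that agree almost everywhere represent the same element of the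
    space, so the metric on the abstract space detects the boundary condition. *)
Lemma fs_eqP (R : realType) (T : Type) (D : set T) (W V : lmodType R)
    (S : function_space D W V) (u v : V) :
  fs_eq S u v <-> u = v.
Proof.
split=> [|->]; first exact: fs_val_inj.
by have FF := fs_ae_filter S; apply: nearW.
Qed.

(** The lower bound matters: [inf] takes the default value [0] on sets that are
    not bounded below. *)
Lemma solves_infP (R : realType) (X : Type) (J : X -> R) (U : set X) (u : X) :
  has_lbound [set J w | w in U] ->
  solves_inf J U u <-> U u /\ forall w, U w -> J u <= J w.
Proof.
move=> lbJ; split=> -[Uu].
  by move=> ->; split=> // w Uw; apply: ge_inf => //; exists w.
move=> minu; split=> //; apply/eqP; rewrite eq_le; apply/andP; split.
  by apply: lb_le_inf; [exists (J u), u | move=> _ [w Uw <-]; exact: minu].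
by apply: ge_inf => //; exists u.
Qed.

(** One feasible zero of a nonnegative objective forces every minimizer to be a
    zero. *)
Lemma zero_minimizerP (R : realType) (X : Type) (J : X -> R) (U : set X)
    (u : X) :
  (forall w, 0 <= J w) -> (exists2 w, U w & J w = 0) ->
  (U u /\ J u = 0) <-> (U u /\ forall w, U w -> J u <= J w).
Proof.
move=> J0 [v Uv Jv0]; split=> -[Uu]; first by move=> ->.
by move=> minu; split=> //; apply/eqP; rewrite eq_le J0 -Jv0 minu.
Qed.

Theorem theorem1 (R : realType) (d : nat) (hd : (1 < d)%N)
    (Q : set 'rV[R]_d) (hQ : domain Q) (hQb : bounded_set Q)
    (Gamma : set 'rV[R]_d) (hGamma : Gamma `<=` boundary Q)
    (X Z P : completeNormedModType R)
    (ip : {dot Z for (@idfun R)}) (hZ : hilbert_norm ip)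
    (WX WZ WP : lmodType R)
    (SX : function_space Q WX X) (SZ : function_space Q WZ Z)
    (SP : function_space Gamma WP P)
    (F : X -> Z) (B : X -> P)
    (dist : P -> P -> R) (hdist : is_metric dist)
    (hwp : well_posed SZ SP F B)
    (f : Z) (g : P) (u : X) :
  let U := [set w : X | solves_pde SZ F f w] in
  (solves_bvp SZ SP F B f g u <->
     solves_inf (fun w : X => 2^-1 * dist (B w) g ^+ 2) U u) /\
  (solves_bvp SZ SP F B f g u <->
     U u /\ forall w : X, U w -> dist (B u) g ^+ 2 <= dist (B w) g ^+ 2).
Proof.
move=> U.
have sol_zero w :
    solves_bvp SZ SP F B f g w <-> U w /\ dist (B w) g ^+ 2 = 0.
  have bcP : solves_bc SP B g w <-> dist (B w) g ^+ 2 = 0.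
    rewrite /solves_bc fs_eqP -(dist_eq0 hdist).
    by split=> [->|/eqP]; [rewrite expr0n | rewrite sqrf_eq0 => /eqP].
  by rewrite /solves_bvp bcP.
have sol_min : solves_bvp SZ SP F B f g u <->
    U u /\ forall w, U w -> dist (B u) g ^+ 2 <= dist (B w) g ^+ 2.
  rewrite sol_zero; apply: (zero_minimizerP _ _ (fun w => dist (B w) g ^+ 2)).
    by move=> w; exact: sqr_ge0.
  have [/(_ f g)[v [/sol_zero[Uv v0] _]] _] := hwp.
  by exists v.
split=> //; rewrite sol_min solves_infP; last first.
  by exists 0 => _ [w _ <-]; rewrite mulr_ge0 ?invr_ge0 ?sqr_ge0.
by split=> -[Uu minu]; split=> // w /minu; rewrite ler_pM2l ?invr_gt0.
Qed.
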